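(* Let $c>0$, $e\ge 0$, $U=cJ$. On the Gaussian leaf $\mathcal G=\{\mathcal N(\mu,\sigma^2):\mu\in\mathbb R,\ \sigma>0\}$ equipped with (the restriction of) the cost metric $\tilde g_{e,U}=2(e+U)\,g_{\mathcal W_2}$, the Gauss curvature equals $$K(\mu,\sigma)=-\,\frac{c\,(c+3e\sigma^2)}{2\,(c+e\sigma^2)^3}\ <\ 0\qquad\text{for all }\sigma>0 .$$ At $e=0$, $K\equiv-\tfrac1{2c}$ for all $\sigma$. For $e>0$, $K$ is strictly increasing in $\sigma$, with $$\partial_\sigma K=\frac{6ce^2\sigma^3}{(c+e\sigma^2)^4}>0,$$ from the limit $-\tfrac{1}{2c}$ as $\sigma\to0$ to the limit $0$ as $\sigma\to\infty$.
   Context: $J(p)=\int |p'|^2/p\,dx$ is the Fisher information of a density $p$ on $\mathbb R$; for $p=\mathcal N(\mu,\sigma^2)$, $J=1/\sigma^2$. $g_{\mathcal W_2}$ is the quadratic Wasserstein (optimal transport) metric on probability measures with finite second moment. On the Gaussian leaf, $\mathcal W_2^2(\mathcal N(\mu_1,\sigma_1^2),\mathcal N(\mu_2,\sigma_2^2))=(\mu_1-\mu_2)^2+(\sigma_1-\sigma_2)^2$, so in the coordinates $(\mu,\sigma)$ the leaf is isometric to the Euclidean half-plane $\{\sigma>0\}$ with $g_{\mathcal W_2}=d\mu^2+d\sigma^2$, and $\tilde g_{e,U}=(2e+2c/\sigma^2)(d\mu^2+d\sigma^2)$. *)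

(* Defs.v *)
From HB Require Import structures.
From mathcomp Require Import all_boot all_order all_algebra.
From mathcomp Require Import all_classical all_reals all_analysis.

Set Implicit Arguments.
Unset Strict Implicit.
Unset Printing Implicit Defensive.

Import Order.TTheory GRing.Theory Num.Theory.
Import numFieldNormedType.Exports.

Local Open Scope classical_set_scope.
Local Open Scope ring_scope.

Section wasserstein.
Context {R : realType}.
Implicit Types P Q : probability (measurableTypeR R) R.

Definition coupling P Q
    (pi : probability (measurableTypeR R * measurableTypeR R)%type R) : Prop :=
  (forall A : set (measurableTypeR R), measurable A -> pi (A `*` setT) = P A) /\
  (forall B : set (measurableTypeR R), measurable B -> pi (setT `*` B) = Q B).

(* The squared distance W_2^2(P, Q); it is finite as soon as P and Q have
   finite second moment. *)
Definition wasserstein2_sq P Q : \bar R :=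
  ereal_inf [set (\int[pi]_z ((z.1 - z.2) ^+ 2)%:E)%E | pi in coupling P Q].

End wasserstein.

Section riemannian_surface.
Context {R : realType}.

(* A metric on a surface is given in a coordinate chart by its Gram matrix
   x |-> (g_ij(x)). *)
Implicit Types (g : 'rV[R]_2 -> 'M[R]_2) (x : 'rV[R]_2) (i j k l : 'I_2).

Definition coord_vec i : 'rV[R]_2 := delta_mx 0 i.

Definition partial i (f : 'rV[R]_2 -> R) x : R := 'D_(coord_vec i) f x.

Definition christoffel g k i j x : R :=
  2^-1 * \sum_l invmx (g x) k l *
    (partial i (fun y => g y j l) x + partial j (fun y => g y i l) x
     - partial l (fun y => g y i j) x).

(* R^l_ijk, with R(d_j, d_k) d_i = \sum_l R^l_ijk d_l and
   R(X, Y) = [nabla_X, nabla_Y] - nabla_[X, Y]. *)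
Definition riemann g l i j k x : R :=
  partial j (christoffel g l i k) x - partial k (christoffel g l i j) x
  + \sum_m (christoffel g l j m x * christoffel g m i k x
            - christoffel g l k m x * christoffel g m i j x).

(* K = g(R(d_0, d_1) d_1, d_0) / det g. *)
Definition gauss_curvature g x : R :=
  (\sum_l g x 0 l * riemann g l 1 0 1 x) / \det (g x).

End riemannian_surface.

Section gaussian_leaf.
Context {R : realType}.
Implicit Types x v : 'rV[R]_2.

(* The point with coordinates (mu, sigma). *)
Definition leaf_point (mu sigma : R) : 'rV[R]_2 :=
  \row_j (if j == 0 then mu else sigma).

Definition gaussian_density x : R -> R := normal_pdf (x 0 0) (x 0 1).

Definition gaussian_law x : probability (measurableTypeR R) R :=
  normal_prob (x 0 0) (x 0 1).

Definition fisher_information (p : R -> R) : \bar R :=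
  (\int[lebesgue_measure]_y (('D_1 p y) ^+ 2 / p y)%:E)%E.

(* The squared norm g_{W_2}(v, v) at x of a tangent vector v of the leaf:
   the squared metric speed at t = 0 of the curve t |-> gaussian_law (x + t v),
   i.e. lim_(t -> 0) W_2(gaussian_law x, gaussian_law (x + t v))^2 / t^2. *)
Definition wasserstein_sqnorm x v : R :=
  lim (fine (wasserstein2_sq (gaussian_law x) (gaussian_law (x + t *: v)))
         / t ^+ 2 @[t --> 0^']).

(* The restriction of g_{W_2} to the leaf, by polarization. *)
Definition wasserstein_metric x : 'M[R]_2 :=
  \matrix_(i, j) (2^-1 *
    (wasserstein_sqnorm x (coord_vec i + coord_vec j)
     - wasserstein_sqnorm x (coord_vec i)
     - wasserstein_sqnorm x (coord_vec j))).

(* U is a functional on densities. *)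
Definition cost_metric (e : R) (U : (R -> R) -> \bar R) x : 'M[R]_2 :=
  (2 * (e + fine (U (gaussian_density x)))) *: wasserstein_metric x.

Definition leaf_curvature (e : R) (U : (R -> R) -> \bar R) (mu sigma : R) : R :=
  gauss_curvature (cost_metric e U) (leaf_point mu sigma).

End gaussian_leaf.

(* Main.v *)
(* For Gaussians W_2^2 = (m1 - m2)^2 + (s1 - s2)^2: affine images of one standard
   Gaussian give a coupling with this cost, and quadratic Kantorovich potentials
   show that no coupling does better.  The squared metric speed is therefore
   Euclidean in the coordinates (mu, sigma), and the Fisher information is
   1 / sigma^2, so the cost metric is h(sigma) (d mu^2 + d sigma^2) with
   h = 2 (e + c / sigma^2).  A conformal metric of this kind has curvature
   K = - (h' / (2 h))' / h, which is the stated rational function of sigma. *)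
Require Import Defs.
From HB Require Import structures.
From mathcomp Require Import all_boot all_order all_algebra.
From mathcomp Require Import all_classical all_reals all_analysis.
From mathcomp Require Import measurable_realfun.
From mathcomp Require Import ring lra.

Import Order.TTheory GRing.Theory Num.Theory.
Import numFieldNormedType.Exports.

Local Open Scope classical_set_scope.
Local Open Scope ring_scope.

Set Implicit Arguments.
Unset Strict Implicit.
Unset Printing Implicit Defensive.

(** * Integration against a measure given by a density *)

Section density.
Import HBNNSimple.
Local Open Scope ereal_scope.

(** The hypothesis on [nu] is the case of indicators, and finite sums over level sets extend it to
    simple functions. Monotone convergence along the increasing approximations [f_ n] passes to the
    limit on both sides. *)
Lemma ge0_integral_density (d : measure_display) (T : measurableType d)
    (R : realType) (mu nu : {measure set T -> \bar R}) (p : T -> R)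
    (f : T -> \bar R) :
  measurable_fun [set: T] p -> (forall x, 0 <= p x)%R ->
  (forall A, measurable A -> nu A = \int[mu]_(x in A) (p x)%:E) ->
  measurable_fun [set: T] f -> (forall x, 0 <= f x) ->
  \int[nu]_x f x = \int[mu]_x (f x * (p x)%:E).
Proof.
move=> mp p0 nuE mf f0; pose f_ := nnsfun_approx measurableT mf.
have cf x : (f_ n x)%:E @[n --> \oo] --> f x by exact: cvg_nnsfun_approx.
have ndf x m n : (m <= n)%N -> (f_ m x <= f_ n x)%R.
  by move=> mn; apply/lefP/nd_nnsfun_approx.
transitivity (limn (fun n => \int[nu]_x (f_ n x)%:E)).
  rewrite -monotone_convergence//.
  - by apply: eq_integral => x _; apply/esym/cvg_lim => //; exact: cf.
  - by move=> n; exact/measurable_EFinP.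
  - by move=> n x _; rewrite lee_fin.
  - by move=> x _ m n mn; rewrite lee_fin; exact: ndf.
transitivity (limn (fun n => \int[mu]_x ((f_ n x)%:E * (p x)%:E))); last first.
  rewrite -monotone_convergence//.
  - apply: eq_integral => x _; apply/cvg_lim => //; exact: (cvgeZr _ (cf x)).
  - by move=> n; apply/measurable_EFinP/measurable_funM.
  - by move=> n x _; rewrite mule_ge0// lee_fin.
  - by move=> x _ m n mn; rewrite -!EFinM lee_fin ler_wpM2r//; exact: ndf.
congr (limn _); apply/funext => n.
rewrite integralT_nnsfun sintegralE.
transitivity (\int[mu]_x (\sum_(k \in range (f_ n))
    (k * \1_(f_ n @^-1` [set k]) x * p x)%:E)); last first.
  by apply: eq_integral => x _; rewrite -EFinM [in RHS]fimfunE mulr_fsuml -fsumEFin.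
rewrite ge0_integral_fsum//; last 2 first.
- by move=> r; apply/measurable_EFinP/measurable_funM => //; exact: measurable_funM.
- move=> r x _; rewrite lee_fin mulr_ge0// -lee_fin.
  by rewrite EFinM nnfun_muleindic_ge0.
apply: eq_fsbigr => r /[!inE] -[x _ <-].
rewrite nuE//.
under [RHS]eq_integral do rewrite -mulrA EFinM.
rewrite ge0_integralZl//; last 3 first.
- by apply/measurable_EFinP; exact: measurable_funM.
- by move=> y _; rewrite lee_fin mulr_ge0.
- by rewrite lee_fin.
congr (_ * _).
rewrite integral_mkcond; apply: eq_integral => y _.
by rewrite restrict_EFin/= patchE indicE; case: ifP; rewrite (mul1r, mul0r).
Qed.
End density.

(** * The second moment of the Gaussian weight *)

Section gauss_second_moment.
Context {R : realType}.
Notation mu := (@lebesgue_measure R).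
Let E (x : R) : R := expR (- x ^+ 2 / 2).

Let is_deriveE (x : R) : is_derive x 1 E (- x * E x).
Proof.
by apply: is_derive_eq; rewrite /GRing.scale/= /E; field.
Qed.

Let is_derive_expR1 (x : R) :
  is_derive x 1 (fun y : R => - expR (1 - y)) (expR (1 - x)).
Proof. by apply: is_derive_eq; rewrite /GRing.scale/=; ring. Qed.

Let continuousE : continuous E.
Proof.
move=> x; apply/differentiable_continuous/derivable1_diffP.
exact: (@ex_derive _ _ _ _ _ _ _ (is_deriveE x)).
Qed.

Let continuous_expR1 : continuous (fun y : R => expR (1 - y)).
Proof.
move=> x; apply: (@continuous_comp _ _ _ (fun y : R => 1 - y) expR).
  by apply: cvgB; [exact: cvg_cst|exact: cvg_id].
exact: continuous_expR.
Qed.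

Let cvg_expR1 : expR (1 - x) @[x --> +oo] --> (0 : R).
Proof.
under eq_fun do rewrite expRD.
by rewrite -(mulr0 (expR 1)); apply: cvgMr; exact: cvgr_expR.
Qed.

Let cvg_xE : x * E x @[x --> +oo] --> (0 : R).
Proof.
apply: (@squeeze_cvgr _ _ _ _ (cst 0) (fun x : R => 2 * x^-1)).
- near=> x.
  have x0 : 0 < x by near: x; exact: nbhs_pinfty_gt.
  rewrite /cst mulr_ge0 ?expR_ge0 ?ltW//=.
  (* This bound gives x^2 < 2 exp(x^2 / 2), hence x E(x) < 2 / x. *)
  have : 1 + x ^+ 2 / 2 <= expR (x ^+ 2 / 2) by exact: expR_ge1Dx.
  rewrite /E mulNr expRN /= => h.
  rewrite ltr_pdivlMr// mulrAC ltr_pdivrMr ?expR_gt0//; nra.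
- exact: cvg_cst.
- rewrite -(mulr0 2); apply: cvgMr.
  apply: (proj2 (@gtr0_cvgV0 R R (pinfty_nbhs R) _ id _)); last exact: cvg_id.
  exact: nbhs_pinfty_gt.
Unshelve. all: by end_near. Qed.

Let integral_derive (f F : R -> R) (l : R) :
  (forall x, 0 <= f x) -> continuous f -> (forall x : R, is_derive x 1 F (f x)) ->
  F x @[x --> +oo] --> l ->
  (\int[lebesgue_measure]_(x in `[0%R, +oo[) (f x)%:E = (l - F 0)%:E)%E.
Proof.
move=> f0 cf dF Fl; rewrite (@ge0_continuous_FTC2y _ f F 0 l) ?EFinB//.
- exact: continuous_subspaceT.
- apply: cvg_at_right_filter; apply/differentiable_continuous/derivable1_diffP.
  exact: (@ex_derive _ _ _ _ _ _ _ (dF 0)).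
- by move=> x _; rewrite derive1E; exact: (@derive_val _ _ _ _ _ _ _ (dF x)).
Qed.

(** This is integration by parts: - x E(x) has derivative (x^2 - 1) E(x) and vanishes at 0 and at
    +oo. Evenness of both integrands reduces the claim to the half-line. *)
Lemma integral_sqr_gauss :
  (\int[mu]_x (x ^+ 2 * expR (- x ^+ 2 / 2))%:E =
   \int[mu]_x (expR (- x ^+ 2 / 2))%:E)%E.
Proof.
have cx2E : continuous (fun x : R => x ^+ 2 * E x).
  move=> x; apply: cvgM; [exact: exprn_continuous|exact: continuousE].
rewrite (ge0_symfun_integralT _ cx2E); last 2 first.
- by move=> x; rewrite mulr_ge0 ?sqr_ge0 ?expR_ge0.
- by move=> x /=; rewrite /E sqrrN.
rewrite (ge0_symfun_integralT _ continuousE); last 2 first.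
- by move=> x; rewrite expR_ge0.
- by move=> x /=; rewrite /E sqrrN.
congr (_ * _)%E; rewrite (_ : [set x | _] = `[0, +oo[%classic); last first.
  by apply/seteqP; split => x/=; rewrite in_itv/= andbT.
have mE : measurable_fun [set: R] E by exact: continuous_measurable_fun.
have mx2E : measurable_fun [set: R] (fun x : R => x ^+ 2 * E x).
  exact: continuous_measurable_fun.
have mexp : measurable_fun [set: R] (fun x : R => expR (1 - x)).
  exact: continuous_measurable_fun.
(* Both sides are compared after adding e^(1 - x), which makes the derivative
   (x^2 - 1) E(x) + e^(1 - x) of - x E(x) - e^(1 - x) nonnegative. *)
pose f (x : R) := (x ^+ 2 - 1) * E x + expR (1 - x).
have E_le x : E x <= expR (1 - x).
  by rewrite ler_expR; have := sqr_ge0 (x - 1); nra.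
have f0 x : 0 <= f x.
  rewrite /f mulrBl mul1r -addrA (addrC (- _)).
  by rewrite addr_ge0// ?subr_ge0// mulr_ge0 ?sqr_ge0 ?expR_ge0.
have cf : continuous f.
  move=> x; apply: cvgD; last exact: continuous_expR1.
  apply: cvgM; last exact: continuousE.
  by apply: cvgB; [exact: exprn_continuous|exact: cvg_cst].
have mf : measurable_fun [set: R] f by exact: continuous_measurable_fun.
have int_exp := @integral_derive (fun x => expR (1 - x)) _ 0
  (fun x => expR_ge0 _) continuous_expR1 is_derive_expR1.
have {}int_exp : (\int[mu]_(x in `[0%R, +oo[)
    (expR (1 - x))%:E = (expR 1)%:E)%E.
  rewrite int_exp; first by rewrite subr0 opprK add0r.
  by rewrite -oppr0; apply: cvgN; exact: cvg_expR1.
pose F (x : R) := - (x * E x) + - expR (1 - x).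
have dF (x : R) : is_derive x 1 F (f x).
  by apply: is_derive_eq; rewrite /f /E /GRing.scale/=; field.
have F0 : F x @[x --> +oo] --> (0 : R).
  have := cvgD (cvgN cvg_xE) (cvgN cvg_expR1); rewrite !oppr0 addr0; exact.
have int_f : (\int[mu]_(x in `[0%R, +oo[) (f x)%:E = (expR 1)%:E)%E.
  rewrite (integral_derive f0 cf dF F0) /F.
  by rewrite mul0r subr0 oppr0 add0r sub0r opprK.
have intD (g h : R -> R) : (forall x, 0 <= g x) -> (forall x, 0 <= h x) ->
    measurable_fun [set: R] g -> measurable_fun [set: R] h ->
    (\int[mu]_(x in `[0%R, +oo[) (g x + h x)%:E =
     \int[mu]_(x in `[0%R, +oo[) (g x)%:E +
     \int[mu]_(x in `[0%R, +oo[) (h x)%:E)%E.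
  move=> g0 h0 mg mh; under eq_integral do rewrite EFinD.
  apply: ge0_integralD => //.
  - by move=> x _; rewrite lee_fin.
  - by apply/measurable_EFinP; exact: measurable_funTS.
  - by move=> x _; rewrite lee_fin.
  - by apply/measurable_EFinP; exact: measurable_funTS.
(* Both e^(1 - x) and [f] have integral e over the half-line, a finite value that can be cancelled
   in the extended reals. *)
have : (\int[mu]_(x in `[0%R, +oo[) (x ^+ 2 * E x + expR (1 - x))%:E =
    \int[mu]_(x in `[0%R, +oo[) (E x + f x)%:E)%E.
  by apply: eq_integral => x _; rewrite /f; congr EFin; ring.
have E0 x : 0 <= E x by exact: expR_ge0.
have x2E0 x : 0 <= x ^+ 2 * E x by rewrite mulr_ge0// sqr_ge0.
have exp0 (x : R) : 0 <= expR (1 - x) by exact: expR_ge0.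
rewrite (intD _ _ x2E0 exp0 mx2E mexp) (intD _ _ E0 f0 mE mf).
rewrite int_exp int_f => /(congr1 (fun z => z - (expR 1)%:E)%E).
by rewrite !addeK.
Qed.

End gauss_second_moment.

(** * The change of variable x = m + s z *)

Section affine_change_of_variable.
Context {R : realType}.
Notation mu := (@lebesgue_measure R).
Variables m s : R.
Hypothesis s0 : 0 < s.
Let phi (z : R) : R := m + s * z.

Lemma measurable_affine : measurable_fun [set: R] phi.
Proof. by apply: measurable_funD => //; exact: measurable_funM. Qed.

Let phiR : measurableTypeR R -> measurableTypeR R := phi.

Let mphiR : measurable_fun [set: measurableTypeR R] phiR.
Proof. exact: measurable_affine. Qed.

(** By uniqueness of Lebesgue measure it suffices to compare both sides on intervals []a, b]], whose
    preimage has length (b - a) / s. *)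
Lemma lebesgue_measure_affine (A : set (measurableTypeR R)) : measurable A ->
  mu A = (s%:E * mu (phi @^-1` A))%E.
Proof.
move=> mA; pose k : {nonneg R} := NngNum (ltW s0).
pose nu : {measure set (measurableTypeR R) -> \bar R} :=
  mscale k (measure_function_pushforward__canonical__measure_function_Measure mu mphiR).
rewrite (@lebesgue_measure_unique _ nu)// => _ [[a b]] _ <-.
rewrite /nu /= /mscale/= /pushforward.
rewrite (_ : _ @^-1` _ = `](a - m) / s, (b - m) / s]%classic); last first.
  apply/seteqP; split=> z /=; rewrite !in_itv/= ltr_pdivrMr// ler_pdivlMr//;
    rewrite /phiR /phi (mulrC z) ltrBlDl lerBrDl//.
rewrite !lebesgue_measure_itv/= !lte_fin ltr_pM2r ?invr_gt0// ltrD2r.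
case: ifPn => _; last by rewrite mule0.
by rewrite -!EFinB -EFinM; congr EFin; field; rewrite gt_eqF.
Qed.

Lemma ge0_integral_affine (D : set (measurableTypeR R))
    (f : measurableTypeR R -> \bar R) :
  measurable D -> measurable_fun D f -> (forall x, 0 <= f x)%E ->
  (\int[mu]_(x in D) f x = s%:E * \int[mu]_(z in phi @^-1` D) f (m + s * (z : R))%R)%E.
Proof.
move=> mD mf f0; pose k : {nonneg R} := NngNum (ltW s0).
pose nu : {measure set (measurableTypeR R) -> \bar R} :=
  measure_function_pushforward__canonical__measure_function_Measure mu mphiR.
rewrite (eq_measure_integral (mscale k nu)); last first.
  by move=> A mA _; exact: lebesgue_measure_affine.
rewrite ge0_integral_mscale//; congr (_ * _)%E.
exact: (ge0_integral_pushforward mphiR).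
Qed.

(** The Jacobian s turns the peak of N(m, s^2) into that of N(0, 1), and the exponents agree at x =
    m + s z. All computations with normal laws are thereby moved to the standard one. *)
Lemma normal_prob_affine (A : set (measurableTypeR R)) : measurable A ->
  normal_prob m s A = normal_prob 0 1 (phi @^-1` A).
Proof.
move=> mA; rewrite /normal_prob ge0_integral_affine//; last 2 first.
- apply: measurable_funTS; apply/measurable_EFinP; exact: measurable_normal_pdf.
- by move=> x; rewrite lee_fin normal_pdf_ge0.
have mphiA : measurable (phi @^-1` A).
  by rewrite -[X in measurable X]setTI; exact: mphiR.
rewrite -ge0_integralZl//; last 3 first.
- apply: measurable_funTS; apply/measurable_EFinP.
  apply: measurableT_comp; [exact: measurable_normal_pdf|exact: measurable_affine].
- by move=> x _; rewrite lee_fin normal_pdf_ge0.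
- by rewrite lee_fin ltW.
apply: eq_integral => z _; rewrite -EFinM; congr EFin.
rewrite !normal_pdfE ?gt_eqF// mulrA; congr (_ * _).
  rewrite /normal_peak expr1n mul1r -mulrnAr sqrtrM ?sqr_ge0//.
  by rewrite sqrtr_sqr gtr0_norm// invfM mulrA divff ?mul1r// gt_eqF.
rewrite /normal_fun; congr expR; field; rewrite gt_eqF//.
Qed.

End affine_change_of_variable.

(** * Integrals against an image measure *)

Section image_measure.
Local Open Scope ereal_scope.
Context (d1 d2 : measure_display) (X : measurableType d1) (Y : measurableType d2).
Context (R : realType) (P : {measure set X -> \bar R}).
Context (Q : {measure set Y -> \bar R}).
Variables (phi : X -> Y) (f : Y -> \bar R).
Hypothesis mphi : measurable_fun [set: X] phi.
Hypothesis QP : forall A, measurable A -> Q A = P (phi @^-1` A).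
Hypothesis mf : measurable_fun [set: Y] f.

Let pushP : {measure set Y -> \bar R} :=
  measure_function_pushforward__canonical__measure_function_Measure P mphi.

Lemma ge0_integral_image : (forall y, 0 <= f y) ->
  \int[Q]_y f y = \int[P]_x f (phi x).
Proof.
move=> f0; rewrite (eq_measure_integral pushP); last by move=> A mA _; exact: QP.
exact: (ge0_integral_pushforward mphi).
Qed.

(** Both directions serve: from the standard Gaussian to a normal law, and from a marginal to a
    coupling. *)
Lemma integrable_image : Q.-integrable [set: Y] f <->
  P.-integrable [set: X] (f \o phi).
Proof.
have absE : \int[Q]_y `|f y| = \int[P]_x `|(f \o phi) x|.
  rewrite (eq_measure_integral pushP); last by move=> A mA _; exact: QP.
  apply: (ge0_integral_pushforward mphi) => //.
  exact: measurableT_comp.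
split=> /integrableP[_ lty]; apply/integrableP; split => //.
- exact: measurableT_comp.
- by rewrite -absE.
- by rewrite absE.
Qed.

Lemma integral_image : P.-integrable [set: X] (f \o phi) ->
  \int[Q]_y f y = \int[P]_x f (phi x).
Proof.
move=> intf; rewrite (eq_measure_integral pushP); last by move=> A mA _; exact: QP.
exact: (integral_pushforward mphi mf intf).
Qed.

End image_measure.

(** * First and second moments of the standard Gaussian *)

Section normal_moments.
Context {R : realType}.
Notation T := (measurableTypeR R).
Notation gamma := (normal_prob (0 : R) 1).

Lemma ge0_integral_normal_prob (m s : R) (f : T -> \bar R) :
  measurable_fun [set: T] f -> (forall x, 0 <= f x)%E ->
  (\int[normal_prob m s]_x f x =
   \int[lebesgue_measure]_x (f x * (normal_pdf m s x)%:E))%E.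
Proof.
move=> mf f0; apply: (@ge0_integral_density _ _ _ _ (normal_prob m s)) => //.
- exact: measurable_normal_pdf.
- by move=> x; exact: normal_pdf_ge0.
Qed.

(** With the constant [normal_peak 1] factored out, [integral_sqr_gauss] identifies the second
    moment with the total mass of the density. *)
Lemma integral_sqr_normal_prob01 : (\int[gamma]_z (z ^+ 2)%:E = 1)%E.
Proof.
have msqr : measurable_fun [set: T] (fun z : T => (z ^+ 2)%:E).
  by apply/measurable_EFinP; exact: exprn_measurable.
rewrite ge0_integral_normal_prob//; last by move=> x; rewrite lee_fin sqr_ge0.
have pdfE (x : R) : normal_pdf 0 1 x = normal_peak 1 * expR (- x ^+ 2 / 2).
  by rewrite normal_pdfE ?oner_neq0// /normal_fun subr0 expr1n.
transitivity (\int[lebesgue_measure]_(x in [set: R]) (normal_pdf 0 1 x)%:E)%E;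
  last exact: integral_normal_pdf.
under eq_integral do rewrite pdfE -EFinM mulrCA EFinM.
under [RHS]eq_integral do rewrite pdfE EFinM.
have mE : measurable_fun [set: T] (fun x : T => expR (- (x : R) ^+ 2 / 2)).
  apply: measurableT_comp => //; apply: measurable_funM => //.
  exact: measurableT_comp.
have mE' : measurable_fun [set: T] (fun x : T => (expR (- (x : R) ^+ 2 / 2))%:E).
  exact/measurable_EFinP.
have mE2 : measurable_fun [set: T]
    (fun x : T => ((x : R) ^+ 2 * expR (- (x : R) ^+ 2 / 2))%:E).
  by apply/measurable_EFinP; exact: measurable_funM.
have peak0 : (0 <= (normal_peak (1 : R))%:E)%E by rewrite lee_fin normal_peak_ge0.
rewrite [RHS](ge0_integralZl _ measurableT mE' _ peak0)//.
rewrite (ge0_integralZl _ measurableT mE2 _ peak0); first by rewrite integral_sqr_gauss.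
by move=> x _; rewrite lee_fin mulr_ge0 ?sqr_ge0 ?expR_ge0.
Qed.

Lemma integrable_sqr_normal_prob01 :
  gamma.-integrable [set: T] (fun z : T => (z ^+ 2)%:E).
Proof.
apply/integrableP; split.
  by apply/measurable_EFinP; exact: exprn_measurable.
under eq_integral do rewrite gee0_abs ?lee_fin ?sqr_ge0//.
by rewrite integral_sqr_normal_prob01 ltry.
Qed.

Lemma integrable_id_normal_prob01 : gamma.-integrable [set: T] EFin.
Proof.
(* The dominating function comes from |z| <= 1 + z^2. *)
apply: (@le_integrable _ _ _ gamma _ _ EFin (fun z : T => 1%:E + (z ^+ 2)%:E)%E).
- by [].
- exact/measurable_EFinP.
- move=> z _; rewrite -EFinD !abse_EFin lee_fin [leRHS]ger0_norm; last first.
    by rewrite addr_ge0 ?sqr_ge0.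
  by rewrite ler_norml; apply/andP; split; nra.
- apply: integrableD => //; last exact: integrable_sqr_normal_prob01.
  exact: finite_measure_integrable_cst.
Qed.

(** The law is invariant under z -> - z, so the mean equals its opposite; being finite by
    integrability, it is 0. *)
Lemma integral_id_normal_prob01 : (\int[gamma]_z z%:E = 0)%E.
Proof.
have mopp : measurable_fun [set: T] (-%R : T -> T) by exact: oppr_measurable.
have opp_sym A : measurable A -> gamma A = gamma ((-%R : T -> T) @^-1` A).
  move=> mA; rewrite {1}/normal_prob.
  rewrite (eq_measure_integral
    (measure_function_pushforward__canonical__measure_function_Measure
       lebesgue_measure mopp)); last first.
    by move=> B mB _; exact/esym/lebesgue_measureN.
  rewrite (ge0_integral_pushforward mopp _ mA); last 2 first.
  - by apply: measurable_funTS; apply/measurable_EFinP; exact: measurable_normal_pdf.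
  - by move=> x _; rewrite lee_fin normal_pdf_ge0.
  apply: eq_integral => x _ /=; congr EFin.
  by rewrite !normal_pdfE ?oner_neq0// /normal_fun !subr0 sqrrN.
have intN : gamma.-integrable [set: T] (fun z : T => (- (z : R))%:E).
  exact: integrableN integrable_id_normal_prob01.
have : (\int[gamma]_z z%:E = - \int[gamma]_z z%:E)%E.
  rewrite -[RHS]integralN; last first.
    exact: integrable_add_def integrable_id_normal_prob01.
  have mid : measurable_fun [set: T] (EFin : T -> \bar R) by exact/measurable_EFinP.
  have := @integral_image _ _ T T R gamma gamma -%R EFin mopp opp_sym mid intN.
  exact.
have := integrable_fin_num measurableT integrable_id_normal_prob01.
move=> /fineK <- [] /eqP; rewrite -addr_eq0 -mulr2n mulrn_eq0/= => /eqP ->.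
by [].
Qed.

End normal_moments.

(** * Quadratic functions integrated against normal laws *)

Section gaussian_wasserstein.
Context {R : realType}.
Notation T := (measurableTypeR R).
Notation gamma := (normal_prob (0 : R) 1).

Lemma measurable_quadratic (a b c m : R) :
  measurable_fun [set: T] (fun x : T => (a * (x - m) ^+ 2 + b * (x - m) + c)%:E).
Proof.
apply/measurable_EFinP; apply: measurable_funD => //.
have mB : measurable_fun [set: T] (fun x : T => (x : R) - m).
  exact: measurable_funB.
by apply: measurable_funD; apply: measurable_funM => //; exact: measurable_funX.
Qed.

Let quadratic01 (a b c : R) :
  gamma.-integrable [set: T] (fun z : T => (a * z ^+ 2 + b * z + c)%:E) /\
  (\int[gamma]_z (a * z ^+ 2 + b * z + c)%:E = (a + c)%:E)%E.
Proof.
have i2 : gamma.-integrable [set: T] (fun z : T => (a%:E * (z ^+ 2)%:E)%E).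
  exact: (integrableZl measurableT a integrable_sqr_normal_prob01).
have i1 : gamma.-integrable [set: T] (fun z : T => (b%:E * z%:E)%E).
  exact: (integrableZl measurableT b integrable_id_normal_prob01).
have i0 : gamma.-integrable [set: T] (fun z : T => c%:E).
  exact: finite_measure_integrable_cst.
have i21 := integrableD measurableT i2 i1.
split; first exact: (integrableD measurableT i21 i0).
under eq_integral do rewrite !EFinD !EFinM.
rewrite (integralD measurableT i21 i0) (integralD measurableT i2 i1).
rewrite (integralZl measurableT integrable_sqr_normal_prob01).
rewrite (integralZl measurableT integrable_id_normal_prob01).
rewrite integral_sqr_normal_prob01 integral_id_normal_prob01 integral_cst//.
by rewrite mule0 mule1 adde0 [X in (_ + _ * X)%E]probability_setT mule1.
Qed.

(** Centring at m makes the substitution m + s z produce a s^2 z^2 + b s z + c, whose integral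
    follows from the moments 1 and 0. The Fisher integrand, the transport cost and the Kantorovich
    potentials all have this form. *)
Lemma normal_prob_quadratic (a b c m s : R) : 0 < s ->
  (normal_prob m s).-integrable [set: T]
    (fun x : T => (a * (x - m) ^+ 2 + b * (x - m) + c)%:E) /\
  (\int[normal_prob m s]_x (a * (x - m) ^+ 2 + b * (x - m) + c)%:E =
   (a * s ^+ 2 + c)%:E)%E.
Proof.
move=> s0; have [i01 e01] := quadratic01 (a * s ^+ 2) (b * s) c.
have E (z : T) : (a * (m + s * z - m) ^+ 2 + b * (m + s * z - m) + c)%:E =
    (a * s ^+ 2 * z ^+ 2 + b * s * z + c)%:E by congr EFin; ring.
have mphi : measurable_fun [set: T] ((fun z => m + s * z) : T -> T).
  exact: measurable_affine.
have NE := normal_prob_affine m s0.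
have mq := measurable_quadratic a b c m.
have i : gamma.-integrable [set: T] ((fun x : T =>
    (a * (x - m) ^+ 2 + b * (x - m) + c)%:E) \o (fun z : T => m + s * z)).
  by rewrite [X in _.-integrable _ X](_ : _ = fun z : T =>
    (a * s ^+ 2 * z ^+ 2 + b * s * z + c)%:E)//; apply/funext => z; exact: E.
split; first exact: ((integrable_image mphi NE mq).2 i).
rewrite (integral_image mphi NE mq i).
by under eq_integral do rewrite E.
Qed.

End gaussian_wasserstein.

(** * Fisher information and Wasserstein distance of Gaussians *)

Section gaussian_leaf_geometry.
Context {R : realType}.
Notation T := (measurableTypeR R).
Notation gamma := (normal_prob (0 : R) 1).

Lemma derive_normal_pdf (m s y : R) : s != 0 ->
  'D_1 (normal_pdf m s) y = - ((y - m) / s ^+ 2) * normal_pdf m s y.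
Proof.
move=> s0; rewrite normal_pdfE//.
apply: derive_val; rewrite /normal_fun.
by apply: is_derive_eq; rewrite /GRing.scale/=; field.
Qed.

(** Here p'^2 / p = s^-4 (y - m)^2 p, so the integral is s^-4 times the variance s^2. *)
Lemma fisher_information_normal (m s : R) : 0 < s ->
  fisher_information (normal_pdf m s) = (s ^- 2)%:E.
Proof.
move=> s0; have sN0 : s != 0 by rewrite gt_eqF.
rewrite /fisher_information.
pose f (y : T) := (s ^- 4 * (y - m) ^+ 2 + 0 * (y - m) + 0)%:E.
transitivity (\int[normal_prob m s]_y f y)%E; last first.
  rewrite (normal_prob_quadratic (s ^- 4) 0 0 m s0).2; congr EFin.
  by field.
rewrite ge0_integral_normal_prob; last 2 first.
- exact: measurable_quadratic.
- move=> y; rewrite lee_fin mul0r !addr0 mulr_ge0 ?sqr_ge0//.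
  by rewrite invr_ge0 exprn_ge0 ?ltW.
apply: eq_integral => y _; rewrite derive_normal_pdf// -EFinM; congr EFin.
have p0 : normal_pdf m s y != 0.
  by rewrite normal_pdfE// gt_eqF// mulr_gt0 ?expR_gt0 ?normal_peak_gt0.
by field; rewrite p0 sN0.
Qed.

(* The optimal coupling sends a standard Gaussian z to (m1 + s1 z, m2 + s2 z);
   the Kantorovich potentials used for optimality are the quadratic functions
   coming from 2 a b <= (s2 / s1) a ^ 2 + (s1 / s2) b ^ 2. *)
Lemma wasserstein2_sq_normal (m1 s1 m2 s2 : R) : 0 < s1 -> 0 < s2 ->
  wasserstein2_sq (normal_prob m1 s1) (normal_prob m2 s2) =
  ((m1 - m2) ^+ 2 + (s1 - s2) ^+ 2)%:E.
Proof.
move=> s10 s20; have mcost : measurable_fun [set: (T * T)%type]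
    (fun z : (T * T)%type => ((z.1 - z.2) ^+ 2)%:E).
  by apply/measurable_EFinP; apply: measurable_funX; exact: measurable_funB.
apply/eqP; rewrite eq_le; apply/andP; split.
- pose Z (z : T) : (T * T)%type := (m1 + s1 * z, m2 + s2 * z).
  have mZ : measurable_fun [set: T] Z.
    by apply/measurable_fun_pairP; split; exact: measurable_affine.
  pose Zm : {mfun T >-> (T * T)%type} := HB.pack Z (isMeasurableFun.Build _ _ _ _ _ mZ).
  pose pi : probability (T * T)%type R := distribution gamma Zm.
  apply: ereal_inf_lbound; exists pi.
    split=> [A mA|B mB].
    + rewrite /pi /= /distribution /pushforward (normal_prob_affine m1 s10 mA).
      by congr (normal_prob _ _ _); apply/seteqP; split => z //= [].
    + rewrite /pi /= /distribution /pushforward (normal_prob_affine m2 s20 mB).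
      by congr (normal_prob _ _ _); apply/seteqP; split => z //= [].
  rewrite (ge0_integral_image mZ (P := gamma)) //; last first.
    by move=> z; rewrite lee_fin sqr_ge0.
  transitivity (\int[gamma]_z ((s1 - s2) ^+ 2 * ((z : R) - 0) ^+ 2 +
      (2 * (m1 - m2) * (s1 - s2)) * (z - 0) + (m1 - m2) ^+ 2)%:E)%E.
    by apply: eq_integral => z _; rewrite /Z/=; congr EFin; ring.
  by rewrite (normal_prob_quadratic _ _ _ _ ltr01).2 expr1n mulr1 addrC.
- apply: le_ereal_inf_tmp => _ [pi [piP piQ] <-].
  have mfst : measurable_fun [set: (T * T)%type] (fst : T * T -> T) by [].
  have msnd : measurable_fun [set: (T * T)%type] (snd : T * T -> T) by [].
  (* With a = x - m1 and b = y - m2 the cost is (a - b + d)^2. Apart from - 2 a b it is a function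
     of x plus a function of y; d^2 is assigned to [f1]. *)
  pose d := m1 - m2.
  pose f1 (x : T) := ((1 - s2 / s1) * (x - m1) ^+ 2 + 2 * d * (x - m1) + d ^+ 2)%:E.
  pose f2 (y : T) := ((1 - s1 / s2) * (y - m2) ^+ 2 + (- 2 * d) * (y - m2) + 0)%:E.
  have mf1 : measurable_fun [set: T] f1 by exact: measurable_quadratic.
  have mf2 : measurable_fun [set: T] f2 by exact: measurable_quadratic.
  have [if1 ef1] := normal_prob_quadratic (1 - s2 / s1) (2 * d) (d ^+ 2) m1 s10.
  have [if2 ef2] := normal_prob_quadratic (1 - s1 / s2) (- 2 * d) 0 m2 s20.
  have Pfst A : measurable A -> normal_prob m1 s1 A = pi (fst @^-1` A).
    by move=> mA; rewrite -piP//; congr (pi _); apply/seteqP; split => z //= [].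
  have Qsnd A : measurable A -> normal_prob m2 s2 A = pi (snd @^-1` A).
    by move=> mA; rewrite -piQ//; congr (pi _); apply/seteqP; split => z //= [].
  have i1 := (integrable_image mfst Pfst mf1).1 if1.
  have i2 := (integrable_image msnd Qsnd mf2).1 if2.
  have e1 := integral_image mfst Pfst mf1 i1.
  have e2 := integral_image msnd Qsnd mf2 i2.
  have -> : ((m1 - m2) ^+ 2 + (s1 - s2) ^+ 2)%:E =
      (\int[pi]_z (f1 z.1 + f2 z.2))%E.
    rewrite (integralD measurableT i1 i2) -e1 -e2 ef1 ef2 -EFinD; congr EFin.
    by rewrite /d; field; rewrite !gt_eqF.
  (* An infinite cost is trivially above the bound; a finite one makes the cost integrable, as
     comparing the integrals requires. *)
  have [->|gNy] := eqVneq (\int[pi]_z ((z.1 - z.2) ^+ 2)%:E)%E +oo%E.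
    by rewrite leey.
  apply: le_integral => //; first exact: (integrableD measurableT i1 i2).
    apply/integrableP; split => //.
    by under eq_integral do rewrite gee0_abs ?lee_fin ?sqr_ge0//; rewrite ltey.
  move=> [x y] _ /=; rewrite /f1 /f2 -EFinD lee_fin -subr_ge0.
  (* The slack is a square that vanishes exactly on the graph of the optimal affine map. *)
  rewrite (_ : _ - _ = (s2 * (x - m1) - s1 * (y - m2)) ^+ 2 / (s1 * s2)).
    by rewrite divr_ge0 ?sqr_ge0// mulr_ge0 ?ltW.
  by rewrite /d; field; rewrite !gt_eqF.
Qed.
End gaussian_leaf_geometry.

(** * The cost metric in the coordinates (mu, sigma) *)

Section gaussian_cost_metric.
Context {R : realType}.
Implicit Types x v : 'rV[R]_2.

(** For small t != 0 the second coordinate of x + t v stays positive, so the distance formula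
    applies and the quotient is constant in t. *)
Lemma wasserstein_sqnorm_leaf x v : 0 < x 0 1 ->
  wasserstein_sqnorm x v = v 0 0 ^+ 2 + v 0 1 ^+ 2.
Proof.
move=> x0; apply/cvg_lim => //; apply: cvg_near_cst.
have cv : x 0 1 + t * v 0 1 @[t --> (0 : R)] --> x 0 1 + 0 * v 0 1.
  by apply: cvgD; [exact: cvg_cst|apply: cvgMl; exact: cvg_id].
have xv0 : 0 < x 0 1 + 0 * v 0 1 by rewrite mul0r addr0.
near=> t.
have t0 : t != 0 by near: t; exact: nbhs_dnbhs_neq.
have xt0 : 0 < x 0 1 + t * v 0 1.
  by near: t; apply: nbhs_dnbhs; exact: (cvgr_gt _ cv _ xv0).
rewrite /gaussian_law wasserstein2_sq_normal// !mxE//=.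
by field.
Unshelve. all: by end_near. Qed.

Lemma wasserstein_metric_leaf x : 0 < x 0 1 -> wasserstein_metric x = 1%:M.
Proof.
move=> x0; apply/matrixP => i j; rewrite !mxE !wasserstein_sqnorm_leaf// !mxE.
by case: i => [[|[|//]] ?]; case: j => [[|[|//]] ?]; rewrite /=; field.
Qed.

Lemma cost_metric_leaf (c e : R) x : 0 < x 0 1 ->
  cost_metric e (fun p => c%:E * fisher_information p)%E x =
  (2 * (e + c / x 0 1 ^+ 2))%:M.
Proof.
move=> x0; rewrite /cost_metric wasserstein_metric_leaf//.
by rewrite fisher_information_normal// scalemx1.
Qed.

End gaussian_cost_metric.

(** * Curvature of a conformal metric depending on sigma only *)

Section conformal_curvature.
Context {R : realType}.
Implicit Types (x : 'rV[R]_2) (i j k l : 'I_2).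

Lemma near_eq_partial i (f g : 'rV[R]_2 -> R) x :
  (\forall y \near x, f y = g y) -> partial i f x = partial i g x.
Proof. exact: near_eq_derive. Qed.

(** The half-plane is open, so formulas valid only for sigma > 0 may be used under [partial]. *)
Lemma near_snd_coord_gt0 x : 0 < x 0 1 -> \forall y \near x, 0 < (y : 'rV[R]_2) 0 1.
Proof.
have cx : (y : 'rV[R]_2) 0 1 @[y --> x] --> x 0 1 by exact: coord_continuous.
exact: (cvgr_gt _ cx).
Qed.

(** Along sigma the difference quotient is the one-variable one; along mu it is identically 0. The
    factor [*+ (i == 1)] merges the two cases. *)
Lemma partial_snd_coord i (f : R -> R) x (df : R) :
  is_derive (x 0 1) 1 f df ->
  partial i (fun y => f (y 0 1)) x = df *+ (i == 1).
Proof.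
move=> dfx; rewrite /partial /derive.
have E (t : R) : (t *: coord_vec i + x) 0 1 = t * (i == 1)%:R + x 0 1.
  by rewrite !mxE /= eq_sym.
case: (i =P 1) => i1.
  rewrite mulr1n -[RHS](@derive_val _ _ _ _ _ _ _ dfx).
  apply: (congr1 (fun F : R -> R => lim (F @ 0^'))); apply/funext => t /=.
  by rewrite E i1 eqxx.
rewrite mulr0n; apply/cvg_lim => //; apply: cvg_near_cst; near=> t.
by rewrite /= E (introF eqP i1) mulr0 add0r subrr scaler0.
Unshelve. all: by end_near. Qed.

(** [h] is the conformal factor, [dh] its derivative, and [dA] the derivative of A = h' / (2 h),
    half the logarithmic derivative of [h]. *)
Variables (g : 'rV[R]_2 -> 'M[R]_2) (h dh dA : R -> R).
Hypothesis gE : forall x, 0 < x 0 1 -> g x = (h (x 0 1))%:M.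
Hypothesis h0 : forall s, 0 < s -> h s != 0.
Hypothesis dhE : forall s : R, 0 < s -> is_derive s 1 h (dh s).
Hypothesis dAE : forall s : R, 0 < s ->
  is_derive s 1 (fun s => dh s / (2 * h s)) (dA s).

Lemma partial_conformal i j k x : 0 < x 0 1 ->
  partial i (fun y => g y j k) x = dh (x 0 1) *+ (i == 1) *+ (j == k).
Proof.
move=> x0.
rewrite (@near_eq_partial _ _ (fun y => h (y 0 1) *+ (j == k))); last first.
  near=> y; have y0 : 0 < y 0 1 by near: y; exact: near_snd_coord_gt0.
  by rewrite gE// mxE.
case: (j == k); first by rewrite !mulr1n; apply: partial_snd_coord; exact: dhE.
by rewrite /partial derive_cst.
Unshelve. all: by end_near. Qed.

Lemma christoffel_conformal k i j x : 0 < x 0 1 ->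
  christoffel g k i j x = dh (x 0 1) / (2 * h (x 0 1)) *
    ((i == 1)%:R *+ (j == k) + (j == 1)%:R *+ (i == k)
     - (k == 1)%:R *+ (i == j)).
Proof.
move=> x0; rewrite /christoffel gE// invmx_scalar.
have := h0 x0.
(* The inverse Gram matrix is scalar, so only the term l = k survives. *)
rewrite (bigD1 k)//= big1 ?addr0; last first.
  by move=> l lk; rewrite !mxE eq_sym (negbTE lk) mul0r.
rewrite !partial_conformal// mxE eqxx mulr1n => ?.
(* The identity holds for arbitrary values of the six Kronecker symbols, so they are treated as
   independent booleans. *)
case: (i == 1); case: (j == 1); case: (k == 1); case: (i == k); case: (j == k);
 case: (i == j); rewrite /= ?mulr1n ?mulr0n; field; done.
Qed.

(** In R^0_101 the only nonzero derivative term is - d_1 Gamma^0_10 = - A', and the products of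
    Christoffel symbols cancel as A^2 - A^2. Then K = h (- A') / h^2. *)
Lemma gauss_curvature_conformal x : 0 < x 0 1 ->
  gauss_curvature g x = - dA (x 0 1) / h (x 0 1).
Proof.
move=> x0; have hN0 := h0 x0.
have dchristoffel i j k l : partial i (christoffel g j k l) x =
    dA (x 0 1) *+ (i == 1) * ((k == 1)%:R *+ (l == j) + (l == 1)%:R *+ (k == j)
     - (j == 1)%:R *+ (k == l)).
  set C : R := (X in _ * X).
  rewrite (@near_eq_partial _ _ (fun y => dh (y 0 1) / (2 * h (y 0 1)) * C));
    last first.
    near=> y; have y0 : 0 < y 0 1 by near: y; exact: near_snd_coord_gt0.
    exact: christoffel_conformal.
  have dAC : is_derive (x 0 1) 1 (fun s => dh s / (2 * h s) * C) (dA (x 0 1) * C).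
    have := dAE x0 => dAx.
    by apply: is_derive_eq; rewrite /GRing.scale/= mulr0 add0r mulrC.
  by rewrite (partial_snd_coord _ dAC) mulrnAl.
rewrite /gauss_curvature gE// det_scalar /riemann !big_ord_recl !big_ord0.
rewrite !mxE /= !dchristoffel !christoffel_conformal//=.
by rewrite /=; field.
Unshelve. all: by end_near. Qed.

End conformal_curvature.

(** * The closed form of the curvature *)

Section gaussian_leaf_curvature.
Context {R : realType}.
Variables c e : R.
Hypotheses (hc : 0 < c) (he : 0 <= e).

Let den_gt0 (s : R) : 0 < s -> 0 < c + e * s ^+ 2.
Proof. by move=> s0; rewrite ltr_pwDl// mulr_ge0 ?sqr_ge0. Qed.

Lemma leaf_curvature_closed_form (mu s : R) : 0 < s ->
  leaf_curvature e (fun p => c%:E * fisher_information p)%E mu s =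
  - (c * (c + 3 * e * s ^+ 2) / (2 * (c + e * s ^+ 2) ^+ 3)).
Proof.
move=> s0; rewrite /leaf_curvature.
pose h (t : R) := 2 * (e + c / t ^+ 2).
pose dh (t : R) := - 4 * c / t ^+ 3.
pose dA (t : R) := c * (c + 3 * e * t ^+ 2) / (t ^+ 2 * (c + e * t ^+ 2) ^+ 2).
have hN0 t : 0 < t -> h t != 0.
  move=> t0; rewrite gt_eqF// mulr_gt0// ltr_wpDl// divr_gt0// exprn_gt0//.
have dhE (t : R) : 0 < t -> is_derive t 1 h (dh t).
  move=> t0; have tN0 : t ^+ 2 != 0 by rewrite gt_eqF// exprn_gt0.
  by apply: is_derive_eq; rewrite /dh /GRing.scale/=; field; rewrite gt_eqF.
have dAE (t : R) : 0 < t -> is_derive t 1 (fun u => dh u / (2 * h u)) (dA t).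
  move=> t0; have tN0 : t * (c + e * t ^+ 2) != 0.
    by rewrite gt_eqF// mulr_gt0// den_gt0.
  (* For u > 0 the quotient h' / (2 h) simplifies to - c / (u (c + e u^2)); this form is
     differentiated and the result carried over by local equality. *)
  have : is_derive t 1 (fun u : R => - c * (u * (c + e * u ^+ 2))^-1) (dA t).
    apply: is_derive_eq; rewrite /dA /GRing.scale/=; field.
    by rewrite !gt_eqF// den_gt0.
  apply: near_eq_is_derive; near=> u.
  have u0 : 0 < u by near: u; exact: (cvgr_gt _ (@cvg_id _ (nbhs t)) _ t0).
  by rewrite /dh /h; field; rewrite (addrC _ c) !gt_eqF ?den_gt0.
have x0 : 0 < leaf_point mu s 0 1 by rewrite mxE.
rewrite (gauss_curvature_conformal _ hN0 dhE dAE)//; last first.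
  by move=> x xp; rewrite cost_metric_leaf.
by rewrite mxE/= /dA /h; field; rewrite !gt_eqF ?den_gt0.
Unshelve. all: by end_near. Qed.

End gaussian_leaf_curvature.

(** * Sign, monotonicity and limits of the curvature *)

Unset Implicit Arguments.

Theorem theorem4p18 (R : realType) (c e : R) (hc : 0 < c) (he : 0 <= e) :
  let U : (R -> R) -> \bar R := fun p => (c%:E * fisher_information p)%E in
  let K : R -> R -> R := leaf_curvature e U in
  [/\ forall mu sigma : R, 0 < sigma ->
        K mu sigma = - (c * (c + 3 * e * sigma ^+ 2)
                        / (2 * (c + e * sigma ^+ 2) ^+ 3))
        /\ K mu sigma < 0,
      e = 0 -> forall mu sigma : R, 0 < sigma -> K mu sigma = - (1 / (2 * c)) &
      0 < e -> forall mu : R,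
        [/\ forall sigma1 sigma2 : R, 0 < sigma1 -> sigma1 < sigma2 ->
              K mu sigma1 < K mu sigma2,
            forall sigma : R, 0 < sigma ->
              is_derive sigma 1 (K mu)
                (6 * c * e ^+ 2 * sigma ^+ 3 / (c + e * sigma ^+ 2) ^+ 4)
              /\ 0 < 6 * c * e ^+ 2 * sigma ^+ 3 / (c + e * sigma ^+ 2) ^+ 4,
            K mu sigma @[sigma --> 0^'+] --> - (1 / (2 * c)) &
            K mu sigma @[sigma --> +oo] --> (0 : R)] ].
Proof.
move=> U K.
have KE : forall mu sigma : R, 0 < sigma -> K mu sigma =
    - (c * (c + 3 * e * sigma ^+ 2) / (2 * (c + e * sigma ^+ 2) ^+ 3)).
  by move=> mu sigma; exact: leaf_curvature_closed_form.
have den0 (s : R) : 0 < c + e * s ^+ 2.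
  by rewrite ltr_pwDl// mulr_ge0 ?sqr_ge0.
split.
- move=> mu s s0; split; first exact: KE.
  rewrite KE// oppr_lt0 divr_gt0//; last by rewrite mulr_gt0// exprn_gt0.
  by rewrite mulr_gt0// ltr_pwDl// mulr_ge0 ?sqr_ge0// mulr_ge0.
- move=> e0 mu s s0; rewrite KE// e0 !(mulr0, mul0r, addr0).
  by field; rewrite gt_eqF.
- move=> ep mu.
  have dK (s : R) : 0 < s -> is_derive s 1 (K mu)
      (6 * c * e ^+ 2 * s ^+ 3 / (c + e * s ^+ 2) ^+ 4).
    move=> s0; have denN0 : 2 * (c + e * s ^+ 2) ^+ 3 != 0.
      by rewrite gt_eqF// mulr_gt0// exprn_gt0.
    (* The closed form is known only for sigma > 0, which holds on a neighbourhood of s. *)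
    apply: (@near_eq_is_derive _ _ _ (fun s : R =>
      - (c * (c + 3 * e * s ^+ 2) / (2 * (c + e * s ^+ 2) ^+ 3)))).
      near=> u; apply/esym/KE; near: u; exact: (cvgr_gt _ (@cvg_id _ (nbhs s)) _ s0).
    by apply: is_derive_eq; rewrite /GRing.scale/=; field; rewrite gt_eqF.
  have dK_gt0 (s : R) : 0 < s ->
      0 < 6 * c * e ^+ 2 * s ^+ 3 / (c + e * s ^+ 2) ^+ 4.
    by move=> s0; rewrite divr_gt0 ?exprn_gt0// !mulr_gt0// ?exprn_gt0.
  split.
  + move=> s1 s2 s10 s12; have s20 := lt_trans s10 s12.
    rewrite !KE// ltrN2 ltr_pdivrMr ?mulr_gt0 ?exprn_gt0//.
    rewrite [ltRHS]mulrAC ltr_pdivlMr ?mulr_gt0 ?exprn_gt0//.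
    have s12sq : e * s1 ^+ 2 < e * s2 ^+ 2.
      by rewrite ltr_pM2l// ltr_sqr ?nnegrE ?ltW.
    have es1 : 0 < e * s1 ^+ 2 by rewrite mulr_gt0// exprn_gt0.
    (* In terms of p = c + e s^2 one has - K = c (3 p - 2 c) / (2 p^3), so the comparison becomes a
       polynomial inequality in c < p < q. *)
    set p := c + e * s1 ^+ 2; set q := c + e * s2 ^+ 2.
    have cp : c < p by rewrite /p ltrDl.
    have pq : p < q by rewrite /p /q ltrD2l.
    rewrite (_ : c + 3 * e * s1 ^+ 2 = 3 * p - 2 * c); last by rewrite /p; ring.
    rewrite (_ : c + 3 * e * s2 ^+ 2 = 3 * q - 2 * c); last by rewrite /q; ring.
    clearbody p q; rewrite -subr_gt0.
    have p0 := lt_trans hc cp; have q0 := lt_trans p0 pq; have cq := lt_trans cp pq.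
    (* The cross-multiplied difference is divisible by q - p, and the cofactor is arranged as a sum
       of terms positive for c < p < q. *)
    rewrite (_ : _ - _ = 2 * c * (q - p) * (2 * p ^+ 2 * (q - c) +
      2 * q ^+ 2 * (p - c) + p * q * (p - c) + p * q * (q - c))); last by ring.
    by rewrite mulr_gt0 ?addr_gt0 ?mulr_gt0 ?subr_gt0 ?exprn_gt0.
  + by move=> s s0; split; [exact: dK|exact: dK_gt0].
  (* The rational expression is continuous at 0 because its denominator there is 2 c^3, and it
     agrees with K on the right of 0. *)
  + pose F (s : R) := - (c * (c + 3 * e * s ^+ 2) / (2 * (c + e * s ^+ 2) ^+ 3)).
    have F0 : F 0 = - (1 / (2 * c)).
      by rewrite /F expr0n/= !mulr0 !addr0; field; rewrite gt_eqF.
    have cF : F s @[s --> (0 : R)] --> F 0.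
      have denN0 : 2 * (c + e * 0 ^+ 2) ^+ 3 != 0.
        by rewrite gt_eqF// mulr_gt0// exprn_gt0.
      have dF : derivable F 0 1 by exact: ex_derive.
      exact/differentiable_continuous/derivable1_diffP.
    rewrite -F0.
    apply: cvg_trans (cvg_at_right_filter cF); apply: near_eq_cvg.
    by near=> s; apply/esym/KE; near: s; exact: nbhs_right_gt.
  (* With D = c + e s^2, the bound c + 3 e s^2 <= 3 D gives - K <= 3 c / (2 D^2). For s > 1, D >= e
     s and D^2 >= e^2 s, whence the lower bound - 3 c / (2 e^2 s) for K. *)
  + apply: (@squeeze_cvgr _ _ _ _ (fun s : R => - (3 * c / (2 * e ^+ 2) * s^-1))
      (cst 0)).
    * near=> s; have s1 : 1 < s by near: s; exact: nbhs_pinfty_gt.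
      have s0 : 0 < s by exact: lt_trans s1.
      rewrite KE//= oppr_le0 lerN2 divr_ge0 ?andbT; last 2 first.
        by rewrite mulr_ge0 ?ltW// ltr_pwDl// mulr_ge0 ?sqr_ge0// mulr_ge0.
        by rewrite mulr_ge0 ?exprn_ge0 ?ltW.
      rewrite ler_pdivrMr ?mulr_gt0 ?exprn_gt0//.
      set D := c + e * s ^+ 2.
      have D0 : 0 < D by exact: den0.
      have cD : c + 3 * e * s ^+ 2 <= 3 * D by rewrite /D; lra.
      have ss : s <= s ^+ 2 by rewrite expr2 ler_peMr// ltW.
      have es : e * s <= D.
        by have : e * s <= e * s ^+ 2 by [rewrite ler_pM2l]; rewrite /D; lra.
      have eD : e ^+ 2 * s <= D ^+ 2.
        apply: (@le_trans _ _ ((e * s) ^+ 2)).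
          by rewrite exprMn ler_pM2l// exprn_gt0.
        by rewrite ler_sqr ?nnegrE// ltW// mulr_gt0.
      rewrite (_ : 3 * c / (2 * e ^+ 2) / s * (2 * D ^+ 3) =
        c * (3 * D) * (D ^+ 2 / (e ^+ 2 * s))); last first.
        by field; rewrite !gt_eqF.
      rewrite (le_trans (ler_wpM2l (ltW hc) cD))// ler_peMr//.
        by rewrite !mulr_ge0 ?ltW.
      by rewrite ler_pdivlMr ?mul1r// mulr_gt0// exprn_gt0.
    * rewrite -oppr0 -(mulr0 (3 * c / (2 * e ^+ 2))); apply: cvgN; apply: cvgMr.
      apply: (proj2 (@gtr0_cvgV0 R R (pinfty_nbhs R) _ id _)); last exact: cvg_id.
      exact: nbhs_pinfty_gt.
    * exact: cvg_cst.
Unshelve. all: by end_near. Qed.
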